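(* Assume the setting in the context. Let $\mathcal{F}$ be a countable collection of functions on $[-1,1]^d$ with $|f|\le B_n$ for all $f\in\mathcal{F}$, and let $L_n:\mathcal{F}\to[0,\infty)$ satisfy $\sum_{f\in\mathcal{F}}e^{-L_n(f)}\le1$. Then $$\mathbb{E}\sup_{f\in\mathcal{F}}\Big\{D_n'(f,f^\star)-\tau P_n(f\|f^\star)-\tau\gamma_nL_n(f)/n\Big\}\le0.$$
   Context: Setting: $d,n\ge1$. $(X,Y)$ is a random pair with $X\in[-1,1]^d$ having law $P$, $Y\in\mathbb{R}$. The regression function $f^\star(x)=\mathbb{E}[Y\mid X=x]$ satisfies $|f^\star|\le B$. The noise $\epsilon=Y-f^\star(X)$ satisfies $\mathbb{V}(\epsilon\mid X)\le\sigma^2$ and the Bernstein condition $\mathbb{E}(|\epsilon|^k\mid X)\le\frac12k!\eta^{k-2}\mathbb{V}(\epsilon\mid X)$ for $k=3,4,\dots$, with $\eta>0$. The data $(X_1,Y_1),\dots,(X_n,Y_n)$ are i.i.d. copies of $(X,Y)$, and $X_1',\dots,X_n'$ are i.i.d. with law $P$, independent of the data. For functions $f,g$: $D_n'(f,g)=\frac1n\sum_{i=1}^n(f(X_i')-g(X_i'))^2$, $P_n(f\|f^\star)=\frac1n\sum_{i=1}^n[(Y_i-f(X_i))^2-(Y_i-f^\star(X_i))^2]$. $B_n\ge B$. For fixed $\delta_1,\delta_2>0$: $\tau=(1+\delta_1)(1+\delta_2)$ and $\gamma_n=(2\tau)^{-1}(1+\delta_1/2)(1+2/\delta_1)(B+B_n)^2+2(1+1/\delta_2)\sigma^2+2(B+B_n)\eta$.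 *)

(* Defs.v *)
From HB Require Import structures.
From mathcomp Require Import all_boot all_order all_algebra.
From mathcomp Require Import all_classical all_reals all_analysis.
Set Implicit Arguments. Unset Strict Implicit. Unset Printing Implicit Defensive.
Import Order.TTheory GRing.Theory Num.Theory.
Local Open Scope classical_set_scope.
Local Open Scope ring_scope.

Definition cube (R : realType) (d : nat) : set (d.-tuple R) :=
  [set x | forall i : 'I_d, -1 <= tnth x i <= 1].

Definition cond_exp_version (R : realType) (d0 d1 : measure_display)
  (Om : measurableType d0) (T : measurableType d1) (Pr : probability Om R)
  (X : Om -> T) (Z : Om -> R) (g : T -> R) : Prop :=
  measurable_fun [set: T] g /\
  forall A : set T, measurable A ->
    (\int[Pr]_(w in X @^-1` A) (Z w)%:E = \int[Pr]_(w in X @^-1` A) (g (X w))%:E)%E.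

Definition mutually_independent (R : realType) (d0 d1 d2 : measure_display)
  (Om : measurableType d0) (T1 : measurableType d1) (T2 : measurableType d2)
  (Pr : probability Om R) (n : nat) (Z : 'I_n -> Om -> T1) (W : 'I_n -> Om -> T2)
  : Prop :=
  forall (A : 'I_n -> set T1) (B : 'I_n -> set T2),
    (forall i, measurable (A i)) -> (forall j, measurable (B j)) ->
    fine (Pr ((\bigcap_(i in [set: 'I_n]) (Z i @^-1` A i))
              `&` (\bigcap_(j in [set: 'I_n]) (W j @^-1` B j))))
    = (\prod_(i < n) fine (Pr (Z i @^-1` A i))) *
      (\prod_(j < n) fine (Pr (W j @^-1` B j))).

Definition gamma_n (R : realType) (B Bn sigma eta delta1 delta2 : R) : R :=
  let tau := (1 + delta1) * (1 + delta2) in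
  (2 * tau)^-1 * (1 + delta1 / 2) * (1 + 2 / delta1) * (B + Bn) ^+ 2
  + 2 * (1 + 1 / delta2) * sigma ^+ 2 + 2 * (B + Bn) * eta.

Definition Dn' (R : realType) (d n : nat) (Xp : 'I_n -> d.-tuple R)
  (f g : d.-tuple R -> R) : R :=
  n%:R^-1 * \sum_(i < n) (f (Xp i) - g (Xp i)) ^+ 2.

Definition Pn (R : realType) (d n : nat) (X : 'I_n -> d.-tuple R) (Y : 'I_n -> R)
  (f fstar : d.-tuple R -> R) : R :=
  n%:R^-1 * \sum_(i < n) ((Y i - f (X i)) ^+ 2 - (Y i - fstar (X i)) ^+ 2).

(* Main.v *)
Require Import Defs.
From HB Require Import structures.
From mathcomp Require Import all_boot all_order all_algebra.
From mathcomp Require Import all_classical all_reals all_analysis.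
From mathcomp Require Import measurable_realfun ring lra.
Import Order.TTheory GRing.Theory Num.Theory.
Import numFieldNormedType.Exports.
Import HBNNSimple.
Local Open Scope classical_set_scope.
Local Open Scope ring_scope.

(** Put g = f - fstar, h = g^2 <= M^2 with M = B + B_n, lam = 1/gamma_n and
    a = lam/tau.  Since x <= e^x - 1, no logarithm or Jensen inequality is
    needed: with c = n/(tau gamma_n),
      c sup_f (Q_f - L_f/c) <= sum_f e^(c Q_f - L_f) - 1,
    so it is enough that E e^(c Q_f) <= 1 for each f, where
    Q_f = D'_n(f, fstar) - tau P_n(f || fstar).  By independence this expectation is
    the n-th power of E e^(a h(X')) E e^(-lam (h(X) - 2 eps g(X))).  Bernstein's
    condition integrates the noise out and bounds the second factor by
    E e^(-a (1 + delta1) h(X)).  The product is then at most 1 because, by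
    symmetrization and cosh x <= e^(x^2/2),
      e^(a h') e^(-a (1 + delta1) h) + e^(a h) e^(-a (1 + delta1) h') <= 2
    for all h, h' in [0, M^2], which is where the constant
    (1 + delta1/2)(1 + 2/delta1) M^2 / (2 tau) in gamma_n comes from.  When
    M = 0, gamma_n may vanish, and the supremum is nonpositive a.s. *)

Set Implicit Arguments.
Unset Strict Implicit.
Unset Printing Implicit Defensive.

(** * Monotonicity of integrals, and integrals weighted by a function of X *)

Section weighted.
Context (d : measure_display) (Om : measurableType d) (R : realType)
  (mu : {measure set Om -> \bar R}).
Local Open Scope ereal_scope.

(** The integral of a nonnegative function is a supremum over the simple functions below it, and
    that set grows with the function. Measurability does not enter, so a supremum over [F] can be
    bounded directly. *)
Lemma le_ge0_integral (D : set Om) (f g : Om -> \bar R) :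
  (forall x, D x -> 0 <= f x) -> (forall x, D x -> f x <= g x) ->
  \int[mu]_(x in D) f x <= \int[mu]_(x in D) g x.
Proof.
move=> f0 fg.
have g0 x : D x -> 0 <= g x by move=> Dx; exact: le_trans (f0 _ Dx) (fg _ Dx).
rewrite integral_mkcond [leRHS]integral_mkcond !ge0_integralTE//.
- apply: ereal_sup_le => _ [h/= hf <-]; exists h => //= x; apply: (le_trans (hf x)).
  rewrite /patch; case: ifPn => //; rewrite inE; exact: fg.
- by move=> x; rewrite /patch; case: ifPn => //; rewrite inE; exact: g0.
- by move=> x; rewrite /patch; case: ifPn => //; rewrite inE; exact: f0.
Qed.

Lemma le_integral_nonmeasurable (D : set Om) (f g : Om -> \bar R) :
  (forall x, D x -> f x <= g x) ->
  \int[mu]_(x in D) f x <= \int[mu]_(x in D) g x.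
Proof.
move=> fg; rewrite integralE [leRHS]integralE; apply: leeB.
- apply: le_ge0_integral => x Dx; first exact: funepos_ge0.
  by rewrite !funeposE ge_max !le_max fg//= lexx orbT.
- apply: le_ge0_integral => x Dx; first exact: funeneg_ge0.
  by rewrite !funenegE ge_max !le_max leeN2 fg//= lexx orbT.
Qed.

Context (d' : measure_display) (T : measurableType d') (X : Om -> T)
  (mX : measurable_fun setT X).

(** The level sets of [g] composed with [X] are preimages under [X], so only integrals of [V] over
    events generated by [X] remain. *)
Lemma integral_nnsfun_comp (g : {nnsfun T >-> R}) (V : Om -> R) :
  measurable_fun setT V -> (forall w, 0 <= V w)%R ->
  \int[mu]_w (g (X w) * V w)%:E =
  \sum_(y \in range g) y%:E * \int[mu]_(w in X @^-1` (g @^-1` [set y])) (V w)%:E.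
Proof.
move=> mV V0.
have mA y : measurable (X @^-1` (g @^-1` [set y])).
  by rewrite -[X in measurable X]setTI; apply: mX => //; exact: measurable_sfunP.
transitivity (\int[mu]_w \sum_(y \in range g)
    (y * \1_(g @^-1` [set y]) (X w) * V w)%:E).
  apply: eq_integral => w _.
  rewrite (fimfunE g (X w)) fsumEFin//; congr EFin.
  rewrite !fsbig_finite//= mulr_suml; apply: eq_bigr => i _.
  by [].
rewrite ge0_integral_fsum//.
- rewrite !fsbig_finite//= [LHS]big_seq [RHS]big_seq; apply: eq_bigr => y.
  rewrite in_fset_set// inE => -[x _ <-].
  rewrite [in RHS]integral_mkcond epatch_indic -ge0_integralZl_EFin//.
  + apply: eq_integral => w _ /=; rewrite !indicE.
    have -> : (w \in X @^-1` (g @^-1` [set g x])) = (X w \in g @^-1` [set g x]).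
      by apply/idP/idP; rewrite !inE.
    by rewrite -!EFinM -mulrA [(V w * _)%R]mulrC.
  + by move=> w _ /=; rewrite -EFinM lee_fin mulr_ge0// indicE.
  + apply: emeasurable_funM; first exact/measurable_EFinP.
    by apply/measurable_EFinP; exact: measurable_indic.
- move=> y; apply/measurable_EFinP; apply: measurable_funM => //.
  apply: measurable_funM => //.
  by apply: (measurableT_comp (measurable_indic _) mX).
- move=> y w _; rewrite lee_fin mulr_ge0// indicE.
  case: (boolP (X w \in g @^-1` [set y])); rewrite ?mulr0//= inE /= => <-.
  by rewrite mulr1.
Qed.

(** This is how conditional inequalities given [X] are exploited: a comparison on the events
    generated by [X] passes to simple weights through their level sets, and then to all nonnegative
    weights by monotone convergence. *)
Lemma weighted_integral_le (V W : Om -> R) (rho : T -> R) :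
  measurable_fun setT V -> (forall w, 0 <= V w)%R ->
  measurable_fun setT W -> (forall w, 0 <= W w)%R ->
  measurable_fun setT rho -> (forall x, 0 <= rho x)%R ->
  (forall A, measurable A -> \int[mu]_(w in X @^-1` A) (V w)%:E <=
                             \int[mu]_(w in X @^-1` A) (W w)%:E) ->
  \int[mu]_w (rho (X w) * V w)%:E <= \int[mu]_w (rho (X w) * W w)%:E.
Proof.
move=> mV V0 mW W0 mrho rho0 VW.
have mr : measurable_fun setT (EFin \o rho) by exact/measurable_EFinP.
pose r n := nnsfun_approx measurableT mr n.
have key (U : Om -> R) : measurable_fun setT U -> (forall w, 0 <= U w)%R ->
  (fun n => \int[mu]_w (r n (X w) * U w)%:E) @ \oo -->
  \int[mu]_w (rho (X w) * U w)%:E.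
  move=> mU U0.
  have -> : \int[mu]_w (rho (X w) * U w)%:E =
      \int[mu]_w limn (fun n => (r n (X w) * U w)%:E).
    apply: eq_integral => w _; apply/esym/cvg_lim => //.
    rewrite EFinM; under eq_fun do rewrite EFinM.
    apply: cvgeZr => //.
    by apply: (cvg_nnsfun_approx measurableT mr) => // x _; rewrite lee_fin.
  apply: cvg_monotone_convergence => //.
  - move=> n; apply/measurable_EFinP; apply: measurable_funM => //.
    by apply: measurableT_comp.
  - by move=> n w _; rewrite lee_fin mulr_ge0.
  - move=> w _ m n mn; rewrite lee_fin ler_wpM2r//.
    exact/lefP/nd_nnsfun_approx.
rewrite -(cvg_lim _ (key V mV V0))// -(cvg_lim _ (key W mW W0))//.
apply: lee_lim; [exact: cvgP (key V mV V0)|exact: cvgP (key W mW W0)|].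
apply: nearW => n.
rewrite !integral_nnsfun_comp//; apply: lee_fsum => // y [x _ <-].
by rewrite lee_wpmul2l ?lee_fin// VW.
Qed.

End weighted.

(** * Products of independent nonnegative variables *)

Section independence.
Context (d : measure_display) (Om : measurableType d) (R : realType)
  (P : probability Om R) (I : finType) (U : I -> Om -> R) (c : I -> R).
Hypothesis mU : forall i, measurable_fun setT (U i).
Hypothesis U0 : forall i w, 0 <= U i w.
Hypothesis Uc : forall i, (\int[P]_w (U i w)%:E <= (c i)%:E)%E.
Hypothesis indU : forall B : I -> set R, (forall i, measurable (B i)) ->
  fine (P (\bigcap_(i in [set: I]) (U i @^-1` B i))) =
  \prod_i fine (P (U i @^-1` B i)).

Let c0 i : 0 <= c i.
Proof. by rewrite -lee_fin (le_trans _ (Uc i))// integral_ge0// => w _; rewrite lee_fin. Qed.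

Let mpre i A : measurable A -> measurable (U i @^-1` A).
Proof. by move=> mA; rewrite -[X in measurable X]setTI; exact: mU. Qed.

Let mcap B : (forall i : I, measurable (B i)) ->
  measurable (\bigcap_(i in [set: I]) (U i @^-1` B i)).
Proof.
by move=> mB; apply: fin_bigcap_measurable => // i _; exact: mpre.
Qed.

Let mprod (s : seq I) : measurable_fun setT (fun w => \prod_(i <- s) U i w).
Proof. exact: measurable_prod. Qed.

(* The coordinates in s carry the function U i, the others an indicator of
   B i; each step trades one indicator for U j by weighted_integral_le. *)
Lemma integral_prod_indep_cap (s : seq I) (B : I -> set R) : uniq s ->
  (forall i, measurable (B i)) -> (forall i, i \in s -> B i = setT) ->
  (\int[P]_(w in \bigcap_(i in [set: I]) (U i @^-1` B i))
      (\prod_(i <- s) U i w)%:E <=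
   (\prod_(i <- s) c i * \prod_i fine (P (U i @^-1` B i)))%:E)%E.
Proof.
elim: s B => [|j s IH] B.
  move=> _ mB _; under eq_integral do rewrite big_nil.
  rewrite integral_cst//; last exact: mcap.
  by rewrite mul1e big_nil mul1r -indU// fineK// fin_num_measure//; exact: mcap.
move=> /= /andP[js us] mB BT.
set K := \prod_(i | i != j) fine (P (U i @^-1` B i)).
have K0 : 0 <= K by apply: prodr_ge0 => i _; exact: fine_ge0.
have BjT : B j = setT by apply: BT; rewrite mem_head.
(* By the induction hypothesis, [V] has integral at most [C] times the probability on every event
   that [U j] lies in [A]; this is the comparison [VC] of [V] with a constant. *)
pose C := \prod_(i <- s) c i * K.
have C0 : 0 <= C by rewrite mulr_ge0// prodr_ge0.
pose D := \bigcap_(i in [set: I]) (U i @^-1` B i).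
have mD : measurable D by exact: mcap.
pose V w := \prod_(i <- s) U i w * \1_D w.
have mV : measurable_fun setT V.
  by apply: measurable_funM => //; exact: measurable_indic.
have V0 w : 0 <= V w by rewrite mulr_ge0// ?prodr_ge0// indicE.
have VC A : measurable A ->
  (\int[P]_(w in U j @^-1` A) (V w)%:E <=
   \int[P]_(w in U j @^-1` A) (cst C w)%:E)%E.
  (* Since [B j] is the whole line, replacing it by [A] intersects [D] with the event that [U j]
     lies in [A]. *)
  move=> mA; pose B' i := if i == j then A else B i.
  have mB' i : measurable (B' i) by rewrite /B'; case: ifP.
  have capB' : \bigcap_(i in [set: I]) (U i @^-1` B' i) = U j @^-1` A `&` D.
    apply/seteqP; split => [w h|w [Aw Dw] i _].
      split; first by have := h j Logic.I; rewrite /B' eqxx.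
      move=> i _; have := h i Logic.I; rewrite /B'; case: eqP => // ->.
      by rewrite BjT.
    by rewrite /B'; case: eqP => [->//|_]; exact: Dw.
  have := IH B' us mB'; rewrite capB'.
  have B'T i : i \in s -> B' i = setT.
    move=> si; rewrite /B'; case: eqP => [ij|_]; first by rewrite -ij si in js.
    by rewrite BT// inE si orbT.
  move=> /(_ B'T); rewrite integral_mkcondr epatch_indic.
  under eq_integral do rewrite /= -EFinM -/(V _).
  move=> /le_trans; apply.
  rewrite (integral_cst P (mpre j mA) C%:E) -[X in (_ * X)%E]fineK; last by apply: fin_num_measure; exact: mpre.
  rewrite -EFinM lee_fin (bigD1 j)//= /B' eqxx.
  rewrite (_ : \prod_(i | i != j) _ = K); first by rewrite mulrCA mulrC.
  by apply: eq_bigr => i /negbTE ->.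
(* The weight must be nonnegative on all of [R], so the absolute value replaces the identity; they
   agree on the values of [U j]. *)
have mabs : measurable_fun setT (fun x : R => `|x|) by exact: normr_measurable.
have := weighted_integral_le (mU j) mV V0 (measurable_cst C) (fun=> C0) mabs
  (@normr_ge0 _ _) VC.
move=> H; rewrite integral_mkcond epatch_indic.
rewrite (eq_integral (fun w => (`|U j w| * V w)%:E)); last first.
  by move=> w _ /=; rewrite big_cons -EFinM ger0_norm// mulrA.
apply: (le_trans H); rewrite /cst.
under eq_integral do rewrite ger0_norm// mulrC EFinM.
rewrite ge0_integralZl_EFin//; last 2 first.
- by move=> w _; rewrite lee_fin.
- exact/measurable_EFinP.
apply: (@le_trans _ _ (C%:E * (c j)%:E)%E); first by rewrite lee_wpmul2l.
rewrite -EFinM lee_fin big_cons (bigD1 j)//= BjT preimage_setT probability_setT.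
by rewrite /= mul1r /C mulrC mulrA.
Qed.

Lemma integral_prod_indep :
  (\int[P]_w (\prod_i U i w)%:E <= (\prod_i c i)%:E)%E.
Proof.
have := @integral_prod_indep_cap (index_enum I) (fun=> setT) (index_enum_uniq I)
  (fun=> measurableT) (fun _ _ => erefl).
have -> : \bigcap_(i in [set: I]) (U i @^-1` setT) = setT by apply/seteqP; split.
rewrite [X in _ * X]big1 ?mulr1// => i _.
by rewrite preimage_setT probability_setT.
Qed.

End independence.

(** * Pointwise inequalities for the exponential *)

Section exponential_inequalities.
Context (R : realType).
Implicit Types x y a h : R.

Lemma cvg_series_exp_coeff x : series (exp_coeff x) @ \oo --> expR x.
Proof. exact: is_cvg_series_exp_coeff. Qed.

Lemma series_exp_coeff_le x n : 0 <= x -> series (exp_coeff x) n <= expR x.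
Proof.
move=> x0; apply: nondecreasing_cvgn_le; last exact: is_cvg_series_exp_coeff.
by apply/nondecreasing_series => k _ _; exact: exp_coeff_ge0.
Qed.

(** Compares the coefficients of order 2n in the series of cosh x and of exp(x^2/2). *)
Lemma expn2_fact_le n : (2 ^ n * n`! <= n.*2`!)%N.
Proof.
elim: n => // n IH; rewrite doubleS !factS expnS.
have -> : (2 * 2 ^ n * (n.+1 * n`!) = n.+1.*2 * (2 ^ n * n`!))%N.
  by rewrite -mul2n; ring.
by rewrite doubleS leq_mul// (leq_trans IH)// leq_pmull.
Qed.

(** Odd powers cancel, and the even ones are dominated term by term. Partial sums of even length are
    compared, then the limit is taken. *)
Lemma expR_pair_le x : expR x + expR (- x) <= 2 * expR (x ^+ 2 / 2).
Proof.
have c2 (y : R) : series (exp_coeff y) (n * 2)%N @[n --> \oo] --> expR y.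
  apply: (@cvg_comp _ _ _ (muln^~ 2%N) (series (exp_coeff y)) \oo \oo).
    exact: cvg_mulnr.
  exact: cvg_series_exp_coeff.
apply: (cvgr_to_le (cvgD (c2 x) (c2 (- x)))); apply: nearW => n.
change (series (exp_coeff x) (n * 2)%N + series (exp_coeff (- x)) (n * 2)%N <=
  2 * expR (x ^+ 2 / 2)).
apply: (@le_trans _ _ (2 * series (exp_coeff (x ^+ 2 / 2)) n)); last first.
  by rewrite ler_wpM2l// series_exp_coeff_le// divr_ge0// sqr_ge0.
elim: n => [|n IH]; first by rewrite mul0n /series/= !big_geq// mulr0 addr0.
rewrite !muln2 doubleS -!muln2 /series/= !big_nat_recr//=.
(* Of the new terms, of orders 2n and 2n + 1, the odd ones cancel and the even ones coincide. *)
rewrite [leLHS](_ : _ = series (exp_coeff x) (n * 2)%N +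
  series (exp_coeff (- x)) (n * 2)%N + 2 * exp_coeff x (n * 2)%N); last first.
  rewrite /series/= /exp_coeff/= muln2 !exprS -mul2n !exprM sqrrN; field.
  by rewrite !pnatr_eq0 -!lt0n !fact_gt0.
rewrite mulrDr lerD// ler_wpM2l// /exp_coeff/= mulnC exprM expr_div_n -mulrA.
rewrite ler_wpM2l//; first by apply: exprn_ge0; exact: sqr_ge0.
rewrite -invfM -natrX -natrM.
rewrite lef_pV2 ?posrE ?ltr0n ?muln_gt0 ?expn_gt0 ?fact_gt0//.
by rewrite ler_nat mul2n expn2_fact_le.
Qed.

(** The two exponents are x - q and -x - q, so the sum is at most 2 exp(x^2/2 - q). The bound (h' -
    h)^2 <= K (h + h') and the condition on [a] give x^2/2 <= q. *)
Lemma expR_symmetrized_le a (delta K h h' : R) : 0 <= a -> 0 < delta ->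
  a * (1 + delta / 2) ^+ 2 * K <= delta ->
  0 <= h <= K -> 0 <= h' <= K ->
  expR (a * h') * expR (- (a * (1 + delta) * h)) +
  expR (a * h) * expR (- (a * (1 + delta) * h')) <= 2.
Proof.
move=> a0 d0 aK /andP[h0 hK] /andP[h'0 h'K].
set x := a * (1 + delta / 2) * (h' - h).
set q := a * (delta / 2) * (h + h').
rewrite -!expRD.
have -> : a * h' + - (a * (1 + delta) * h) = x - q by rewrite /x /q; field.
have -> : a * h + - (a * (1 + delta) * h') = - x - q by rewrite /x /q; field.
rewrite !expRD -mulrDl.
apply: (le_trans (ler_wpM2r (expR_ge0 _) (expR_pair_le x))).
rewrite -mulrA -expRD -[leRHS]mulr1 ler_wpM2l// expR_le1 subr_le0.
have hh : (h' - h) ^+ 2 <= K * (h + h') by nra.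
rewrite ler_pdivrMr// /x /q.
have -> : a * (delta / 2) * (h + h') * 2 = a * (h + h') * delta by field.
apply: (@le_trans _ _ (a * (h + h') * (a * (1 + delta / 2) ^+ 2 * K))).
  rewrite !exprMn.
  have -> : a * (h + h') * (a * (1 + delta / 2) ^+ 2 * K) =
    a ^+ 2 * (1 + delta / 2) ^+ 2 * (K * (h + h')) by ring.
  by rewrite ler_wpM2l// mulr_ge0// sqr_ge0.
by rewrite ler_wpM2l// mulr_ge0// addr_ge0.
Qed.

(** The first-order term keeps its sign, because it will integrate to zero; absolute values from
    order two on give a nonnegative series, which can be integrated term by term. *)
Lemma expR_le_eseries y :
  ((expR y)%:E <= (1 + y)%:E +
    \sum_(0 <= k <oo) (`|y| ^+ k.+2 / k.+2`!%:R)%:E)%E.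
Proof.
have t0 k : (0 <= (`|y| ^+ k.+2 / k.+2`!%:R)%:E)%E by rewrite lee_fin divr_ge0.
have part n : ((series (exp_coeff y) (n + 2)%N)%:E <= (1 + y)%:E +
    \sum_(0 <= k <oo) (`|y| ^+ k.+2 / k.+2`!%:R)%:E)%E.
  apply: (@le_trans _ _ ((1 + y)%:E + \sum_(0 <= k < n) (`|y| ^+ k.+2 / k.+2`!%:R)%:E)%E); last first.
    by rewrite leeD2l// nneseries_lim_ge.
  rewrite sumEFin -EFinD lee_fin addnC /series/= big_nat_recl// big_nat_recl//.
  rewrite /exp_coeff/= expr0 expr1 !divr1 addrA lerD2l ler_sum// => k _.
  by rewrite ler_wpM2r// -normrX ler_norm.
move: part; set S := (\sum_(_ <= _ <oo) _)%E; case: S => [r| |] part.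
- rewrite -EFinD lee_fin.
  apply: (@cvgr_to_le _ \oo _ _ (series (exp_coeff y))).
    exact: cvg_series_exp_coeff.
  near=> n; have := part (n - 2)%N; rewrite -EFinD lee_fin subnK//.
  by near: n; exact: nbhs_infty_ge.
- by rewrite addey// leey.
- by have := part 0%N.
Unshelve. all: by end_near. Qed.

End exponential_inequalities.

(** * Integrating out the noise under Bernstein's condition *)

Section bernstein.
Context (R : realType).

Lemma nneseries_geometric (a z : R) : 0 <= z < 1 ->
  (\sum_(0 <= k <oo) (a * z ^+ k)%:E = (a / (1 - z))%:E)%E.
Proof.
move=> /andP[z0 z1]; have nz1 : `|z| < 1 by rewrite ger0_norm.
rewrite (_ : (fun n => _) = EFin \o series (geometric a z)); last first.
  by apply/funext => n; rewrite /= sumEFin.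
rewrite EFin_lim; last exact: is_cvg_geometric_series.
by congr EFin; apply/cvg_lim => //; exact: cvg_geometric_series.
Qed.

Lemma maxr0B (x : R) : Num.max x 0 - Num.max (- x) 0 = x.
Proof. by case: (leP x 0) => ?; case: (leP (- x) 0) => ?; lra. Qed.

Lemma maxr0D (x : R) : Num.max x 0 + Num.max (- x) 0 = `|x|.
Proof.
case/orP: (le_total 0 x) => x0.
  by rewrite max_l// max_r ?oppr_le0// addr0 ger0_norm.
by rewrite max_r// max_l ?oppr_ge0// add0r ler0_norm.
Qed.

Context (d : measure_display) (Om : measurableType d) (P : probability Om R)
  (d' : measure_display) (T : measurableType d') (X : Om -> T) (e : Om -> R)
  (s2 eta : R).
Hypotheses (mX : measurable_fun setT X) (me : measurable_fun setT e).
Hypotheses (s20 : 0 <= s2) (eta0 : 0 <= eta).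
Hypothesis mean0 : forall A, measurable A ->
  (\int[P]_(w in X @^-1` A) (Num.max (e w) 0)%:E =
   \int[P]_(w in X @^-1` A) (Num.max (- e w) 0)%:E)%E.
Hypothesis moments : forall (k : nat) A, measurable A ->
  (\int[P]_(w in X @^-1` A) (`|e w| ^+ k.+2)%:E <=
   \int[P]_(w in X @^-1` A) (2^-1 * k.+2`!%:R * eta ^+ k * s2)%:E)%E.

Let mep : measurable_fun setT (fun w => Num.max (e w) 0).
Proof. exact: measurable_maxr. Qed.
Let men : measurable_fun setT (fun w => Num.max (- e w) 0).
Proof. by apply: measurable_maxr => //; exact: measurable_funN. Qed.
Let mabsX (f : Om -> R) k : measurable_fun setT f ->
  measurable_fun setT (fun w => `|f w| ^+ k).
Proof.
by move=> mf; apply: measurable_funX; exact: (measurableT_comp (@normr_measurable _ _) mf).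
Qed.

(** In the expansion of the exponential, the linear term vanishes by [mean0], and the term of order
    k + 2 is at most psi t^2 (s2/2) (eta b)^k by [moments]; these bounds form a geometric series.
    The weight [psi] stands for conditioning on [X]. *)
Lemma bernstein_exp_le (psi t : T -> R) (b : R) :
  measurable_fun setT psi -> measurable_fun setT t ->
  (forall x, 0 <= psi x <= 1) -> (forall w, `|t (X w)| <= b) -> eta * b < 1 ->
  (\int[P]_w (psi (X w) * expR (t (X w) * e w))%:E <=
   \int[P]_w (psi (X w) * (1 + s2 / 2 / (1 - eta * b) * t (X w) ^+ 2))%:E)%E.
Proof.
move=> mpsi mt psi01 tb etab.
have psi0 x : 0 <= psi x by case/andP: (psi01 x).
have psi1 x : psi x <= 1 by case/andP: (psi01 x).
have b0 : 0 <= b by exact: le_trans (tb point).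
have mpX : measurable_fun setT (psi \o X) by exact: measurableT_comp.
have mtX : measurable_fun setT (t \o X) by exact: measurableT_comp.
pose tp x := Num.max (t x) 0; pose tn x := Num.max (- t x) 0.
have tp0 x : 0 <= tp x by rewrite le_max lexx orbT.
have tn0 x : 0 <= tn x by rewrite le_max lexx orbT.
have mtp : measurable_fun setT tp by exact: measurable_maxr.
have mtn : measurable_fun setT tn.
  by apply: measurable_maxr => //; exact: measurable_funN.
pose ep w := Num.max (e w) 0; pose en w := Num.max (- e w) 0.
have ep0 w : 0 <= ep w by rewrite le_max lexx orbT.
have en0 w : 0 <= en w by rewrite le_max lexx orbT.
(* The linear term psi t e equals (pp + nn) - (pn + np), with all four products nonnegative. *)
pose pp w := psi (X w) * tp (X w) * ep w.
pose nn w := psi (X w) * tn (X w) * en w.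
pose pn w := psi (X w) * tp (X w) * en w.
pose np w := psi (X w) * tn (X w) * ep w.
have mptp : measurable_fun setT (fun x => psi x * tp x) by exact: measurable_funM.
have mptn : measurable_fun setT (fun x => psi x * tn x) by exact: measurable_funM.
have mptpX : measurable_fun setT (fun w => psi (X w) * tp (X w)).
  exact: (measurableT_comp mptp mX).
have mptnX : measurable_fun setT (fun w => psi (X w) * tn (X w)).
  exact: (measurableT_comp mptn mX).
have mpp : measurable_fun setT pp by exact: measurable_funM.
have mnn : measurable_fun setT nn by exact: measurable_funM.
have mpn : measurable_fun setT pn by exact: measurable_funM.
have mnp : measurable_fun setT np by exact: measurable_funM.
have pp0 w : 0 <= pp w by rewrite !mulr_ge0.
have nn0 w : 0 <= nn w by rewrite !mulr_ge0.
have pn0 w : 0 <= pn w by rewrite !mulr_ge0.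
have np0 w : 0 <= np w by rewrite !mulr_ge0.
have Ipos : (\int[P]_w (pp w + nn w)%:E <= \int[P]_w (pn w + np w)%:E)%E.
  under eq_integral do rewrite EFinD.
  under [leRHS]eq_integral do rewrite EFinD.
  rewrite !ge0_integralD//; try by [move=> *; rewrite lee_fin | exact/measurable_EFinP].
  apply: leeD.
    apply: (weighted_integral_le mX mep ep0 men en0 mptp) => [x|A mA].
      by rewrite mulr_ge0.
    by rewrite mean0.
  apply: (weighted_integral_le mX men en0 mep ep0 mptn) => [x|A mA].
    by rewrite mulr_ge0.
  by rewrite mean0.
(* Finiteness permits the final cancellation; it follows from b |e| <= b (1 + e^2) and the second
   moment. *)
have Ineg : (\int[P]_w (pn w + np w)%:E \is a fin_num)%E.
  rewrite ge0_fin_numE; last first.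
    by apply: integral_ge0 => w _; rewrite lee_fin addr_ge0.
  apply: (@le_lt_trans _ _ (\int[P]_w (b + b * (`|e w| ^+ 2))%:E)%E).
    apply: le_ge0_integral => w _; rewrite lee_fin ?addr_ge0//.
    have tpb : tp (X w) <= b.
      by rewrite ge_max b0 andbT (le_trans (ler_norm _)).
    have tnb : tn (X w) <= b.
      by rewrite ge_max b0 andbT (le_trans (ler_norm _))// normrN.
    have := maxr0D (e w); rewrite -/(ep w) -/(en w) => epen.
    have H (u v : R) : 0 <= u <= b -> 0 <= v -> psi (X w) * u * v <= b * v.
      move=> /andP[u0 ub] v0; rewrite ler_wpM2r// -[leRHS]mul1r.
      exact: ler_pM.
    apply: (@le_trans _ _ (b * `|e w|)).
      by rewrite -epen mulrDr addrC lerD// H// ?tp0 ?tn0.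
    by rewrite -[X in X + _]mulr1 -mulrDr ler_wpM2l//; nra.
  under eq_integral do rewrite EFinD EFinM.
  rewrite ge0_integralD//; last 2 first.
  - by move=> w _; rewrite mule_ge0// lee_fin.
  - by apply/measurable_EFinP; apply: measurable_funM => //; exact: mabsX.
  rewrite integral_cst// [X in (_ * X + _)%E]probability_setT mule1.
  rewrite ge0_integralZl_EFin//; last first.
    by apply/measurable_EFinP; exact: mabsX.
  rewrite lte_add_pinfty ?ltry// lte_mul_pinfty//.
  have := moments 0 measurableT; rewrite preimage_setT => /le_lt_trans; apply.
  by rewrite integral_cst// [X in (_ * X)%E]probability_setT mule1 ltry.
pose g k w := (psi (X w) * `|t (X w)| ^+ k.+2 / k.+2`!%:R) * `|e w| ^+ k.+2.
have rho0 k x : 0 <= psi x * `|t x| ^+ k.+2 / k.+2`!%:R.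
  by apply: divr_ge0 => //; apply: mulr_ge0 => //; exact: exprn_ge0.
have g0 k w : 0 <= g k w by apply: mulr_ge0 => //; exact: exprn_ge0.
have C0 k : 0 <= 2^-1 * k.+2`!%:R * eta ^+ k * s2.
  apply: mulr_ge0 => //; apply: mulr_ge0; last exact: exprn_ge0.
  by apply: mulr_ge0; rewrite ?invr_ge0.
have mrho k : measurable_fun setT (fun x => psi x * `|t x| ^+ k.+2 / k.+2`!%:R).
  apply: measurable_funM => //; apply: measurable_funM => //.
  by apply: measurable_funX; exact: (measurableT_comp (@normr_measurable _ _) mt).
have mg k : measurable_fun setT (g k).
  apply: measurable_funM; last exact: mabsX.
  exact: (measurableT_comp (mrho k) mX).
(* The factorial in the moment bound cancels the one in the exponential series, and k of the k + 2
   factors |t| are bounded by [b]. *)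
have Ig k : (\int[P]_w (g k w)%:E <=
    \int[P]_w (psi (X w) * (t (X w)) ^+ 2 * (s2 / 2 * (eta * b) ^+ k))%:E)%E.
  have := weighted_integral_le mX (mabsX k.+2 me) (fun w => exprn_ge0 _ (normr_ge0 _))
    (measurable_cst (2^-1 * k.+2`!%:R * eta ^+ k * s2)) _ (mrho k) _ (moments k).
  move=> /(_ (fun=> C0 k) (rho0 k)) H; apply: (le_trans H).
  apply: le_ge0_integral => w _; rewrite lee_fin.
    by apply: mulr_ge0; [exact: rho0|exact: C0].
  rewrite (_ : _ * _ = psi (X w) * t (X w) ^+ 2 * (s2 / 2 * (eta * `|t (X w)|) ^+ k)).
    apply: ler_wpM2l; first by apply: mulr_ge0 => //; exact: sqr_ge0.
    apply: ler_wpM2l; first exact: divr_ge0.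
    by rewrite lerXn2r ?nnegrE ?mulr_ge0// ler_wpM2l.
  rewrite -(real_normK (num_real (t (X w)))) !exprS expr0 exprMn /cst; field.
  by rewrite pnatr_eq0 -lt0n fact_gt0.
pose q w := psi (X w) * (t (X w)) ^+ 2.
have q0 w : 0 <= q w by rewrite mulr_ge0// sqr_ge0.
have mq : measurable_fun setT q.
  by apply: measurable_funM => //; exact: measurable_funX.
have IS : (\sum_(0 <= k <oo) \int[P]_w (g k w)%:E <=
   \int[P]_w (q w * (s2 / 2 / (1 - eta * b)))%:E)%E.
  apply: (@le_trans _ _ (\sum_(0 <= k <oo)
     \int[P]_w (q w * (s2 / 2 * (eta * b) ^+ k))%:E)%E).
    apply: lee_nneseries => [k _ _|k _]; last exact: Ig.
    by apply: integral_ge0 => w _; rewrite lee_fin.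
  rewrite -integral_nneseries//; last 2 first.
  - by move=> k; apply/measurable_EFinP; exact: measurable_funM.
  - move=> k w _; rewrite lee_fin; apply: mulr_ge0 => //.
    by apply: mulr_ge0; rewrite ?divr_ge0// exprn_ge0// mulr_ge0.
  rewrite le_eqVlt; apply/orP; left; apply/eqP; apply: eq_integral => w _.
  under eq_eseriesr do rewrite mulrA.
  rewrite nneseries_geometric; first by rewrite !mulrA.
  by rewrite mulr_ge0.
have mE : measurable_fun setT (fun w => psi (X w) * expR (t (X w) * e w)).
  apply: measurable_funM => //; apply: (measurableT_comp (@measurable_expR R)).
  exact: measurable_funM.
(* The unbounded linear term is split into nonnegative parts so that it can
   be cancelled on both sides of an inequality in [0, +oo]. *)
have main : (\int[P]_w (psi (X w) * expR (t (X w) * e w))%:E +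
    \int[P]_w (pn w + np w)%:E <=
    \int[P]_w (psi (X w) * (1 + s2 / 2 / (1 - eta * b) * t (X w) ^+ 2))%:E +
    \int[P]_w (pn w + np w)%:E)%E.
  rewrite -ge0_integralD//; last 4 first.
  - by move=> w _; rewrite lee_fin mulr_ge0// expR_ge0.
  - exact/measurable_EFinP.
  - by move=> w _; rewrite lee_fin addr_ge0.
  - by apply/measurable_EFinP; exact: measurable_funD.
  apply: (@le_trans _ _ (\int[P]_w ((psi (X w))%:E + (pp w + nn w)%:E +
     \sum_(0 <= k <oo) (g k w)%:E))%E).
    apply: le_ge0_integral => w _.
      by rewrite adde_ge0// lee_fin ?addr_ge0// mulr_ge0// expR_ge0.
    have := lee_wpmul2l (_ : 0 <= (psi (X w))%:E)%E (expR_le_eseries (t (X w) * e w)).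
    rewrite lee_fin => /(_ (psi0 _)).
    rewrite muleDr// -nneseriesZl; last by move=> k _; rewrite lee_fin divr_ge0.
    rewrite (eq_eseriesr (g := fun k => (g k w)%:E)); last first.
      by move=> k _; rewrite -EFinM /g normrM exprMn; congr EFin; ring.
    rewrite -!EFinM => /leeD2r -/(_ (pn w + np w)%:E)/le_trans; apply.
    rewrite addeAC -!EFinD leeD2r// lee_fin.
    rewrite mulrDr mulr1 -addrA lerD2l -lerBrDr.
    have -> : t (X w) * e w = (tp (X w) - tn (X w)) * (ep w - en w).
      by rewrite /tp /tn /ep /en !maxr0B.
    rewrite /pp /nn /pn /np.
    by rewrite le_eqVlt; apply/orP; left; apply/eqP; ring.
  rewrite ge0_integralD//; last 4 first.
  - by move=> w _; rewrite adde_ge0// lee_fin// addr_ge0.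
  - by apply: emeasurable_funD; apply/measurable_EFinP => //; exact: measurable_funD.
  - by move=> w _; apply: nneseries_ge0 => k _ _; rewrite lee_fin.
  - apply: ge0_emeasurable_sum => // [k w _ _|k _]; rewrite ?lee_fin//.
    exact/measurable_EFinP.
  rewrite integral_nneseries//; last 2 first.
  - by move=> k; exact/measurable_EFinP.
  - by move=> k w _; rewrite lee_fin.
  rewrite ge0_integralD//; last 4 first.
  - by move=> w _; rewrite lee_fin.
  - exact/measurable_EFinP.
  - by move=> w _; rewrite lee_fin addr_ge0.
  - by apply/measurable_EFinP; exact: measurable_funD.
  apply: (le_trans (leeD (leeD (lexx _) Ipos) IS)).
  rewrite addeAC -ge0_integralD//; last 4 first.
  - by move=> w _; rewrite lee_fin.
  - exact/measurable_EFinP.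
  - move=> w _; rewrite lee_fin mulr_ge0// divr_ge0 ?divr_ge0//.
    by rewrite subr_ge0 ltW.
  - by apply/measurable_EFinP; exact: measurable_funM.
  rewrite leeD2r// le_eqVlt; apply/orP; left; apply/eqP; apply: eq_integral => w _.
  by rewrite -EFinD /q; congr EFin; ring.
by move: main; rewrite leeD2rE.
Qed.

End bernstein.

(** * Symmetrization and the supremum over the class *)

Section probability_integrals.
Context (R : realType) (d : measure_display) (Om : measurableType d)
  (P : probability Om R).

Lemma integral_law_eq (d' : measure_display) (T : measurableType d')
  (Z Z' : Om -> T) (phi : T -> R) :
  measurable_fun setT Z -> measurable_fun setT Z' ->
  measurable_fun setT phi -> (forall x, 0 <= phi x) ->
  (forall A, measurable A -> P (Z @^-1` A) = P (Z' @^-1` A)) ->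
  (\int[P]_w (phi (Z w))%:E = \int[P]_w (phi (Z' w))%:E)%E.
Proof.
move=> mZ mZ' mphi phi0 ZZ'.
have push W : measurable_fun setT W ->
    (\int[P]_w (phi (W w))%:E = \int[pushforward P W]_x (phi x)%:E)%E.
  move=> mW; rewrite ge0_integral_pushforward ?preimage_setT//.
  - exact/measurable_EFinP.
  - by move=> x _; rewrite lee_fin.
by rewrite !push//; apply: eq_measure_integral => A mA _; exact: ZZ'.
Qed.

Lemma ge0_integral_fineE (f : Om -> R) : (forall w, 0 <= f w) ->
  (\int[P]_w (f w)%:E < +oo)%E ->
  (\int[P]_w (f w)%:E = (fine (\int[P]_w (f w)%:E))%:E)%E.
Proof.
move=> f0 foo; rewrite fineK// ge0_fin_numE// integral_ge0// => w _.
by rewrite lee_fin.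
Qed.

(** With an independent copy w' of w, the left side of the pointwise bound has mean 2 E p E q. The
    two variables are integrated one after the other, first w with w' frozen, so no product space is
    formed. *)
Lemma integral_symmetrized_le1 (p q : Om -> R) :
  measurable_fun setT p -> measurable_fun setT q ->
  (forall w, 0 <= p w) -> (forall w, 0 <= q w) ->
  (forall w w', p w' * q w + p w * q w' <= 2) ->
  (\int[P]_w (p w)%:E < +oo)%E -> (\int[P]_w (q w)%:E < +oo)%E ->
  fine (\int[P]_w (p w)%:E) * fine (\int[P]_w (q w)%:E) <= 1.
Proof.
move=> mp mq p0 q0 pq fp fq.
set p_ := fine _; set q_ := fine _.
have p_0 : 0 <= p_ by rewrite fine_ge0// integral_ge0// => w _; rewrite lee_fin.
have q_0 : 0 <= q_ by rewrite fine_ge0// integral_ge0// => w _; rewrite lee_fin.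
have I2 (x y : R) (f g : Om -> R) : 0 <= x -> 0 <= y ->
    measurable_fun setT f -> measurable_fun setT g ->
    (forall w, 0 <= f w) -> (forall w, 0 <= g w) ->
    (forall w, x * f w + y * g w <= 2) ->
    (\int[P]_w (f w)%:E < +oo)%E -> (\int[P]_w (g w)%:E < +oo)%E ->
    x * fine (\int[P]_w (f w)%:E) + y * fine (\int[P]_w (g w)%:E) <= 2.
  move=> x0 y0 mf mg f0 g0 fg foo goo; rewrite -lee_fin EFinD !EFinM -!ge0_integral_fineE//.
  rewrite -!ge0_integralZl_EFin//; try by [move=> *; rewrite lee_fin|exact/measurable_EFinP].
  rewrite -ge0_integralD//; try by [move=> *; rewrite mule_ge0// lee_fin
    |apply/measurable_EFinP; exact: measurable_funM].
  apply: (@le_trans _ _ (\int[P]_w 2%:E)%E).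
    apply: le_ge0_integral => w _; last by rewrite -!EFinM -EFinD lee_fin.
    by rewrite -!EFinM -EFinD lee_fin addr_ge0// mulr_ge0.
  by rewrite integral_cst// [X in (_ * X)%E]probability_setT mule1.
have H w' : p w' * q_ + q w' * p_ <= 2.
  by apply: I2 => // w; rewrite [q w' * _]mulrC.
have : q_ * p_ + p_ * q_ <= 2.
  by apply: I2 => // w; rewrite mulrC [p_ * _]mulrC.
by rewrite mulrC; lra.
Qed.

(* The supremum is bounded through x <= e^x - 1 by a sum over F, which is
   enumerated by an injection p : F -> nat, of partial inverse q. *)
Lemma integral_sup_penalized_le0 (I : choiceType) (F : set I) (L : I -> R)
  (Q : I -> Om -> R) (c : R) : 0 < c -> countable F ->
  (forall f, F f -> measurable_fun setT (Q f)) ->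
  (forall f, F f -> (\int[P]_w (expR (c * Q f w))%:E <= 1)%E) ->
  (\esum_(f in F) (expR (- L f))%:E <= 1)%E ->
  (\int[P]_w ereal_sup [set (Q f w - L f / c)%:E | f in F] <= 0)%E.
Proof.
move=> c0 /countable_injP[p pinj] mQ expQ sumL.
have q_ k : {o : option I | forall f, o = Some f <-> F f /\ p f = k}.
  have [ex|nex] := pselect (exists f, F f /\ p f = k).
    exists (Some (sval (cid ex))) => f; case: (cid ex) => g [Fg gk] /=.
    split=> [[<-]//|[Ff fk]]; congr Some; apply: pinj; rewrite ?inE//.
    by rewrite gk fk.
  by exists None => f; split=> // -[Ff fk]; case: nex; exists f.
pose q k := sval (q_ k).
have qP k f : q k = Some f <-> F f /\ p f = k by rewrite /q; case: (q_ k).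
have qF f : F f -> q (p f) = Some f by move=> Ff; apply/qP.
(* Indices outside the image of [F] contribute the default value 0. *)
pose g k w := oapp (fun f => expR (c * Q f w - L f)) 0 (q k).
have g0 k w : (0 <= (g k w)%:E)%E.
  by rewrite lee_fin /g; case: (q k) => //= f; exact: expR_ge0.
have mQe f : F f -> measurable_fun setT (fun w => expR (c * Q f w)).
  move=> Ff; apply: (measurableT_comp (@measurable_expR R)).
  by apply: measurable_funM => //; exact: mQ.
have mg k : measurable_fun setT (fun w => (g k w)%:E).
  apply/measurable_EFinP; rewrite /g; case E: (q k) => [f|] //=.
  apply: (measurableT_comp (@measurable_expR R)); apply: measurable_funB => //.
  by apply: measurable_funM => //; apply: mQ; case/qP: E.
pose l k : \bar R := (oapp (fun f => expR (- L f)) 0 (q k))%:E.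
have l0 k : (0 <= l k)%E.
  by rewrite lee_fin; case: (q k) => //= f; exact: expR_ge0.
have suml : (\sum_(0 <= k <oo) l k <= 1)%E.
  rewrite nneseries_esumT//; apply: le_trans sumL.
  rewrite (esumID (p @` F)); last by move=> *; exact: l0.
  rewrite setTI [X in (_ + X)%E]esum1 ?adde0; last first.
    move=> k [_ npk]; rewrite /l; case E: (q k) => [f|]//=.
    by case/qP: E => Ff fk; case: npk; exists f.
  rewrite (reindex_esum F (p @` F) p); last first.
    split; [by move=> f Ff; exists f|exact: pinj|by []].
  by apply: le_esum => f Ff; rewrite /l qF.
have gl k : (\int[P]_w (g k w)%:E <= l k)%E.
  rewrite /g /l; case E: (q k) => [f|] /=; last by rewrite integral0.
  have Ff : F f by case/qP: E.
  under eq_integral do rewrite addrC expRD EFinM.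
  rewrite ge0_integralZl_EFin ?expR_ge0//; last by apply/measurable_EFinP; exact: mQe.
  rewrite -[leRHS]mule1; apply: lee_wpmul2l; last exact: expQ.
  by rewrite lee_fin expR_ge0.
pose G w := (\sum_(0 <= k <oo) (g k w)%:E)%E.
have G0 w : (0 <= G w)%E by apply: nneseries_ge0 => k _ _; exact: g0.
have mG : measurable_fun setT G by apply: ge0_emeasurable_sum.
have IG : (\int[P]_w G w <= 1)%E.
  rewrite integral_nneseries//; apply: le_trans suml.
  apply: lee_nneseries => [k _ _|k _]; [exact: integral_ge0|exact: gl].
have iG : P.-integrable setT G.
  apply/integrableP; split=> //.
  under eq_integral do rewrite gee0_abs//.
  exact: le_lt_trans IG (ltry _).
have i1 : P.-integrable setT (cst 1%E : Om -> \bar R).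
  exact: finite_measure_integrable_cst.
apply: (@le_trans _ _ (\int[P]_w (c^-1%:E * (G w - cst 1 w)))%E).
  apply: le_integral_nonmeasurable => w _.
  apply: ge_ereal_sup => _ [f Ff <-].
  have -> : Q f w - L f / c = c^-1 * (c * Q f w - L f) by field; rewrite gt_eqF.
  rewrite EFinM; apply: lee_wpmul2l; first by rewrite lee_fin invr_ge0 ltW.
  apply: (@le_trans _ _ ((expR (c * Q f w - L f))%:E - 1)%E).
    by rewrite -EFinB lee_fin lerBrDl expR_ge1Dx.
  (* The partial sum of length [(p f).+1] is the first to contain the term of [f]. *)
  rewrite leeB//; apply: le_trans (nneseries_lim_ge (p f).+1 _) => [|k _ _]; last exact: g0.
  rewrite big_nat_recr//= {2}/g qF//= leeDr//.
  by apply: sume_ge0 => k _; exact: g0.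
rewrite integralZl//; last exact: integrableB.
apply: mule_ge0_le0; first by rewrite lee_fin invr_ge0 ltW.
rewrite integralB// integral_cst// [X in (_ - _ * X)%E]probability_setT mule1.
by rewrite sube_le0.
Qed.

End probability_integrals.

(** * Conditional moments and the bound for one observation *)

Section noise.
Context (R : realType) (d : measure_display) (Om : measurableType d)
  (P : probability Om R) (d' : measure_display) (T : measurableType d')
  (X : Om -> T) (Y : Om -> R).
Hypotheses (mX : measurable_fun setT X) (mY : measurable_fun setT Y).

Lemma cond_exp_version_le (Z : Om -> R) (g : T -> R) (c : R) :
  cond_exp_version P X Z g -> 0 <= c -> (forall w, g (X w) <= c) ->
  forall A, measurable A ->
  (\int[P]_(w in X @^-1` A) (Z w)%:E <= \int[P]_(w in X @^-1` A) c%:E)%E.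
Proof.
move=> [mg gZ] c0 gc A mA; rewrite gZ//; apply: le_integral_nonmeasurable => w _.
by rewrite lee_fin.
Qed.

(** [cond_exp_version] equates integrals without asserting integrability. The finite second moment
    makes [e] integrable, hence also [Y], so the integrals can be subtracted and then split into
    finite positive and negative parts. *)
Lemma centered_pos_neg (g : T -> R) (b : R) : cond_exp_version P X Y g ->
  (forall w, `|g (X w)| <= b) ->
  (\int[P]_w (`|Y w - g (X w)| ^+ 2)%:E < +oo)%E ->
  forall A, measurable A ->
  (\int[P]_(w in X @^-1` A) (Num.max (Y w - g (X w)) 0)%:E =
   \int[P]_(w in X @^-1` A) (Num.max (- (Y w - g (X w))) 0)%:E)%E.
Proof.
move=> [mg gY] gb e2 A mA.
pose e w := Y w - g (X w).
have mgX : measurable_fun setT (fun w => g (X w)) by exact: measurableT_comp.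
have me : measurable_fun setT e by exact: measurable_funB.
have mXA : measurable (X @^-1` A).
  by rewrite -[X in measurable X]setTI; exact: mX.
have ie : P.-integrable setT (EFin \o e).
  apply/integrableP; split; first exact/measurable_EFinP.
  apply: (@le_lt_trans _ _ (\int[P]_w (1 + (`|e w| ^+ 2)%:E))%E).
    apply: le_ge0_integral => w _ //=.
    by rewrite -EFinD lee_fin; nra.
  have me2 : measurable_fun setT (fun w => (`|e w| ^+ 2)%:E).
    apply/measurable_EFinP; apply: measurable_funX.
    exact: (measurableT_comp (@normr_measurable _ _) me).
  rewrite ge0_integralD//.
  by rewrite integral_cst// [X in (_ * X + _)%E]probability_setT mule1 lte_add_pinfty// ltry.
have ig : P.-integrable setT (EFin \o (fun w => g (X w))).
  apply: measurable_bounded_integrable => //.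
    by rewrite [X in (X < _)%E]probability_setT ltry.
  by exists b; split; [exact: num_real|move=> x bx w _; exact: le_trans (gb w) (ltW bx)].
have iY : P.-integrable setT (EFin \o Y).
  rewrite (_ : EFin \o Y = (EFin \o e) \+ (EFin \o (fun w => g (X w))))%E; last first.
    by apply/funext => w /=; rewrite -EFinD /e subrK.
  exact: integrableD.
have iS f : P.-integrable setT f -> P.-integrable (X @^-1` A) f.
  exact: integrableS.
have Ie : (\int[P]_(w in X @^-1` A) (e w)%:E = 0)%E.
  rewrite (eq_integral (fun w => (Y w)%:E - (g (X w))%:E)%E); last first.
    by move=> w _; rewrite -EFinB.
  rewrite (integralB mXA (iS _ iY) (iS _ ig)) gY// subee//.
  exact: (integrable_fin_num mXA (iS _ ig)).
move: Ie; rewrite integralE => /eqP.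
have fp := integrable_pos_fin_num mXA (iS _ ie).
have fn := integrable_neg_fin_num mXA (iS _ ie).
rewrite sube_eq ?fin_num_adde_defl// add0e => /eqP H.
transitivity (\int[P]_(w in X @^-1` A) (fun w => (e w)%:E)^\+ w)%E.
  by apply: eq_integral => w _; rewrite funeposE EFin_max.
by rewrite H; apply: eq_integral => w _; rewrite funenegE EFin_max.
Qed.

(** Puts the variance bound, as order two with coefficient 2!/2 = 1, and the Bernstein bounds of
    higher order into one family. *)
Lemma bernstein_moments (g v : T -> R) (s2 eta : R) :
  0 <= s2 -> 0 <= eta ->
  cond_exp_version P X (fun w => (Y w - g (X w)) ^+ 2) v ->
  (forall w, v (X w) <= s2) ->
  (forall k : nat, (3 <= k)%N -> exists mk : T -> R,
     cond_exp_version P X (fun w => `|Y w - g (X w)| ^+ k) mk /\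
     forall w, mk (X w) <= 2^-1 * k`!%:R * eta ^+ (k - 2) * v (X w)) ->
  forall (k : nat) A, measurable A ->
  (\int[P]_(w in X @^-1` A) (`|Y w - g (X w)| ^+ k.+2)%:E <=
   \int[P]_(w in X @^-1` A) (2^-1 * k.+2`!%:R * eta ^+ k * s2)%:E)%E.
Proof.
move=> s20 eta0 hv vs hb k A mA.
have c0 j : 0 <= 2^-1 * j.+2`!%:R * eta ^+ j :> R.
  by apply: mulr_ge0; [apply: mulr_ge0; rewrite ?invr_ge0|exact: exprn_ge0].
case: k => [|k].
  under eq_integral do rewrite real_normK ?num_real//.
  have -> : 2^-1 * 2`!%:R * eta ^+ 0 * s2 = s2 :> R.
    by rewrite (_ : 2`! = 2%N)// expr0 mulr1 mulVf ?mul1r.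
  exact: (cond_exp_version_le hv).
have [mk [hmk mkv]] := hb k.+3 isT.
apply: (cond_exp_version_le hmk) => // [|w]; first exact: mulr_ge0.
by rewrite (le_trans (mkv w))// subn2/=; exact: ler_wpM2l.
Qed.

(** Each summand of [gam] has its task: the first, [A], pays for the symmetrization, the second for
    the variance of the noise, the third for the ratio of the geometric series. *)
Lemma single_letter (f g : T -> R) (M s2 eta delta1 delta2 : R) :
  let tau := (1 + delta1) * (1 + delta2) in
  let gam := (2 * tau)^-1 * (1 + delta1 / 2) * (1 + 2 / delta1) * M ^+ 2
    + 2 * (1 + 1 / delta2) * s2 + 2 * M * eta in
  measurable_fun setT f -> measurable_fun setT g ->
  0 < M -> 0 <= s2 -> 0 <= eta -> 0 < delta1 -> 0 < delta2 ->
  (forall w, `|f (X w) - g (X w)| <= M) ->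
  (forall A, measurable A ->
    (\int[P]_(w in X @^-1` A) (Num.max (Y w - g (X w)) 0)%:E =
     \int[P]_(w in X @^-1` A) (Num.max (- (Y w - g (X w))) 0)%:E)%E) ->
  (forall (k : nat) A, measurable A ->
    (\int[P]_(w in X @^-1` A) (`|Y w - g (X w)| ^+ k.+2)%:E <=
     \int[P]_(w in X @^-1` A) (2^-1 * k.+2`!%:R * eta ^+ k * s2)%:E)%E) ->
  exists cu cw : R, [/\
    (\int[P]_w (expR (gam^-1 / tau * (f (X w) - g (X w)) ^+ 2))%:E <= cu%:E)%E,
    (\int[P]_w (expR (- gam^-1 *
       ((Y w - f (X w)) ^+ 2 - (Y w - g (X w)) ^+ 2)))%:E <= cw%:E)%E &
    cu * cw <= 1].
Proof.
move=> tau gam mf mg M0 s20 eta0 d10 d20 fgM mean0 moments.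
have tau0 : 0 < tau by rewrite mulr_gt0// addr_gt0.
pose A := (2 * tau)^-1 * (1 + delta1 / 2) * (1 + 2 / delta1) * M ^+ 2.
(* Uses delta1 (1 + 2/delta1) = 2 (1 + delta1/2). *)
have EA : delta1 * (tau * A) = (1 + delta1 / 2) ^+ 2 * M ^+ 2.
  by rewrite /A; field; rewrite !gt_eqF.
have A0 : 0 < A.
  rewrite -(pmulr_rgt0 _ tau0) -(pmulr_rgt0 _ d10) EA.
  by apply: mulr_gt0; apply: exprn_gt0 => //; rewrite addr_gt0// divr_gt0.
have s2d : 0 <= 2 * (1 + 1 / delta2) * s2.
  by apply: mulr_ge0 => //; apply: mulr_ge0 => //; rewrite addr_ge0// divr_ge0// ltW.
have Meta : 0 <= 2 * M * eta by apply: mulr_ge0 => //; apply: mulr_ge0 => //; exact: ltW.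
have gam0 : 0 < gam by rewrite /gam -/A; lra.
pose lam := gam^-1; have lam0 : 0 < lam by rewrite invr_gt0.
have lamK : lam * gam = 1 by rewrite mulVf// gt_eqF.
pose a := lam / tau; have a0 : 0 < a by rewrite divr_gt0.
pose h x := (f x - g x) ^+ 2.
have h0 x : 0 <= h x by exact: sqr_ge0.
have hM w : h (X w) <= M ^+ 2.
  by rewrite /h -real_normK ?num_real// lerXn2r ?nnegrE ?(ltW M0).
have mfg : measurable_fun setT (fun x => f x - g x) by exact: measurable_funB.
have mh : measurable_fun setT h by exact: measurable_funX.
have mhX : measurable_fun setT (fun w => h (X w)) by exact: (measurableT_comp mh mX).
have mexp c : measurable_fun setT (fun w => expR (c * h (X w))).
  by apply: (measurableT_comp (@measurable_expR R)); exact: measurable_funM.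
pose p w := expR (a * h (X w)); pose q w := expR (- (a * (1 + delta1) * h (X w))).
have mp : measurable_fun setT p by exact: mexp.
have mq : measurable_fun setT q.
  rewrite /q; under eq_fun do rewrite -mulNr; exact: mexp.
have bounded_oo (k : Om -> R) (b : R) : (forall w, 0 <= k w <= b) ->
    (\int[P]_w (k w)%:E < +oo)%E.
  move=> kb; apply: (@le_lt_trans _ _ (\int[P]_w b%:E)%E).
    by apply: le_ge0_integral => w _; rewrite lee_fin; case/andP: (kb w).
  by rewrite integral_cst// [X in (_ * X)%E]probability_setT mule1 ltry.
have poo : (\int[P]_w (p w)%:E < +oo)%E.
  apply: (bounded_oo _ (expR (a * M ^+ 2))) => w.
  by rewrite expR_ge0 ler_expR ler_wpM2l// ltW.
have qoo : (\int[P]_w (q w)%:E < +oo)%E.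
  apply: (bounded_oo _ 1) => w; rewrite expR_ge0 expR_le1 oppr_le0.
  apply: mulr_ge0 => //; apply: mulr_ge0; first exact: ltW.
  by rewrite addr_ge0// ltW.
exists (fine (\int[P]_w (p w)%:E)), (fine (\int[P]_w (q w)%:E)); split.
- by rewrite -ge0_integral_fineE// => w; exact: expR_ge0.
- rewrite -ge0_integral_fineE//; last by move=> w; exact: expR_ge0.
  have etab : eta * (2 * lam * M) < 1.
    rewrite -[ltRHS]lamK (_ : eta * _ = lam * (2 * M * eta)); last by ring.
    by rewrite ltr_pM2l// /gam -/A; lra.
  pose psi x := expR (- lam * h x); pose t x := 2 * lam * (f x - g x).
  have mpsi : measurable_fun setT psi.
    by apply: (measurableT_comp (@measurable_expR R)); exact: measurable_funM.
  have mt : measurable_fun setT t by exact: measurable_funM.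
  have psi01 x : 0 <= psi x <= 1.
    by rewrite expR_ge0 expR_le1 mulNr oppr_le0 mulr_ge0// ltW.
  have tb w : `|t (X w)| <= 2 * lam * M.
    by rewrite normrM ger0_norm ?ler_wpM2l ?mulr_ge0// ltW.
  have me : measurable_fun setT (fun w => Y w - g (X w)).
    by apply: measurable_funB => //; exact: measurableT_comp.
  have := bernstein_exp_le mX me s20 eta0 mean0 moments mpsi mt psi01 tb etab.
  (* With e = Y - g(X), the difference of squares is h(X) - 2 e (f - g)(X), so the exponential
     factors as psi(X) exp(t(X) e). *)
  rewrite (eq_integral (fun w => (expR (- gam^-1 *
       ((Y w - f (X w)) ^+ 2 - (Y w - g (X w)) ^+ 2)))%:E)); last first.
    move=> w _; rewrite /psi /t -expRD /h -/lam; congr (expR _)%:E; ring.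
  move=> /le_trans; apply; apply: le_ge0_integral => w _.
    rewrite lee_fin mulr_ge0 ?expR_ge0// addr_ge0// mulr_ge0 ?sqr_ge0//.
    by rewrite divr_ge0 ?divr_ge0// subr_ge0 ltW.
  rewrite lee_fin.
  apply: (@le_trans _ _ (psi (X w) * expR (lam * (delta2 / (1 + delta2)) * h (X w)))).
    rewrite ler_wpM2l ?expR_ge0//; apply: le_trans (expR_ge1Dx _).
    rewrite lerD2l /t exprMn mulrA; apply: ler_wpM2r; first exact: sqr_ge0.
    rewrite [leLHS]mulrAC ler_pdivrMr ?subr_gt0//.
    have -> : s2 / 2 * (2 * lam) ^+ 2 = lam * (2 * lam * s2) by field.
    rewrite -[leRHS]mulrA; apply: ler_wpM2l; first exact: ltW.
    rewrite [leRHS]mulrAC ler_pdivlMr ?addr_gt0//.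
    (* Writing 1 as [lam * gam] cancels the third summand of [gam]; the second yields exactly the
       required variance term, and the rest is positive. *)
    have -> : delta2 * (1 - eta * (2 * lam * M)) =
       delta2 * (lam * A) + 2 * lam * s2 * (1 + delta2).
      by rewrite -[X in X - _]lamK /gam -/A; field; rewrite gt_eqF.
    by rewrite lerDr; apply: ltW; apply: mulr_gt0 => //; exact: mulr_gt0.
  (* The exponents add up to -lam h / (1 + delta2) = -a (1 + delta1) h. *)
  rewrite -expRD ler_expR le_eqVlt; apply/orP; left; apply/eqP.
  by rewrite /a /tau; field; rewrite !gt_eqF// addr_gt0.
- apply: integral_symmetrized_le1 => //; try by move=> w; exact: expR_ge0.
  move=> w w'; apply: (@expR_symmetrized_le _ a delta1 (M ^+ 2)) => //.
  + exact: ltW.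
  (* By [EA] the condition reads delta1 lam A <= delta1, which holds since A <= gam. *)
  + rewrite -mulrA -EA /a.
    have -> : lam / tau * (delta1 * (tau * A)) = delta1 * (lam * A).
      by field; rewrite gt_eqF.
    rewrite ger_pMr// -[leRHS]lamK ler_pM2l// /gam -/A; lra.
  + by rewrite h0 hM.
  + by rewrite h0 hM.
Qed.

End noise.

(** * Almost sure statements *)

Lemma measurable_cube (R : realType) (d : nat) : measurable (@cube R d).
Proof.
rewrite (_ : @cube R d = \bigcap_(i in [set: 'I_d])
    ((fun x : d.-tuple R => tnth x i) @^-1` `[-1, 1]%classic)).
  apply: fin_bigcap_measurable => // i _.
  rewrite -[X in measurable X]setTI; exact: measurable_tnth.
apply/seteqP; split=> [x cx i _|x cx i]; first by rewrite /= in_itv/= cx.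
by have := cx i I; rewrite /= in_itv.
Qed.

(** [S] lies below the function equal to +oo on the null set [N] and to 0 elsewhere, whose integral
    is 0. *)
Lemma integral_le0_ae (R : realType) (d0 : measure_display)
  (Om : measurableType d0) (P : probability Om R) (S : Om -> \bar R) :
  {ae P, forall w, (S w <= 0)%E} -> (\int[P]_w S w <= 0)%E.
Proof.
move=> [N [mN PN0 SN]].
apply: (@le_trans _ _ (\int[P]_w ((cst +oo%E : Om -> \bar R) \_ N) w)%E).
  apply: le_integral_nonmeasurable => w _; rewrite /patch.
  case: ifPn => [_|]; first exact: leey.
  by rewrite notin_setE => Nw; apply: contrapT => Sw; apply: Nw; exact: SN.
by rewrite -integral_mkcond integral_cst// [X in (_ * X)%E]PN0 mule0.
Qed.


(** [X0] lies in the cube everywhere, but the sample shares only its law, so membership transfers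
    almost surely. *)
Lemma ae_preimage_law (R : realType) (d0 d1 : measure_display)
  (Om : measurableType d0) (T : measurableType d1) (P : probability Om R)
  (Z Z' : Om -> T) (C : set T) :
  measurable_fun setT Z -> measurable C ->
  (forall A, measurable A -> P (Z @^-1` A) = P (Z' @^-1` A)) ->
  (forall w, C (Z' w)) -> {ae P, forall w, C (Z w)}.
Proof.
move=> mZ mC ZZ' CZ'; exists (Z @^-1` (~` C)); split=> //.
- rewrite -[X in measurable X]setTI; apply: mZ => //; exact: measurableC.
- rewrite ZZ'; last exact: measurableC.
  rewrite (_ : _ @^-1` _ = set0) ?measure0//.
  by apply/seteqP; split=> // w /= /(_ (CZ' w)).
Qed.

Lemma ae_forall_ord (R : realType) (d0 : measure_display)
  (Om : measurableType d0) (P : probability Om R) (n : nat)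
  (Q : 'I_n -> Om -> Prop) :
  (forall i, {ae P, forall w, Q i w}) -> {ae P, forall w, forall i, Q i w}.
Proof.
move=> aeQ.
have : {ae P, forall w, forall k, forall i : 'I_n, val i = k -> Q i w}.
  apply/ae_foralln => k; have [kn|nk] := ltnP k n.
    apply: filterS (aeQ (Ordinal kn)) => w Qw i ik.
    by rewrite (_ : i = Ordinal kn)//; apply: val_inj.
  by apply: aeW => w i ik; move: (ltn_ord i); rewrite ik ltnNge nk.
by apply: filterS => w Qw i; exact: (Qw i).
Qed.

(** * The risk bound for the countable class *)

Unset Implicit Arguments.

Theorem theorem4 (R : realType) (d n : nat) (hd : (1 <= d)%N) (hn : (1 <= n)%N)
  (d0 : measure_display) (Om : measurableType d0) (Pr : probability Om R)
  (* the generic pair (X, Y) *)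
  (X0 : Om -> d.-tuple R) (Y0 : Om -> R)
  (* data (X_i, Y_i) and ghost sample X'_i *)
  (X : 'I_n -> Om -> d.-tuple R) (Y : 'I_n -> Om -> R) (Xp : 'I_n -> Om -> d.-tuple R)
  (fstar v : d.-tuple R -> R)
  (B Bn sigma eta delta1 delta2 : R)
  (* measurability *)
  (mX0 : measurable_fun [set: Om] X0) (mY0 : measurable_fun [set: Om] Y0)
  (mX : forall i, measurable_fun [set: Om] (X i))
  (mY : forall i, measurable_fun [set: Om] (Y i))
  (mXp : forall i, measurable_fun [set: Om] (Xp i))
  (* X in [-1,1]^d *)
  (hX0 : forall w, @cube R d (X0 w))
  (* f* = E[Y | X], |f*| <= B *)
  (hfstar : cond_exp_version Pr X0 Y0 fstar)
  (hB : forall x, @cube R d x -> `|fstar x| <= B)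
  (* v(X) = V(eps | X) = E[eps^2 | X] (since E[eps | X] = 0), and V(eps | X) <= sigma^2 *)
  (hv : cond_exp_version Pr X0 (fun w => (Y0 w - fstar (X0 w)) ^+ 2) v)
  (hsigma : forall x, @cube R d x -> v x <= sigma ^+ 2)
  (* Bernstein condition *)
  (heta : 0 < eta)
  (hbern : forall k : nat, (3 <= k)%N -> exists mk : d.-tuple R -> R,
     cond_exp_version Pr X0 (fun w => `|Y0 w - fstar (X0 w)| ^+ k) mk /\
     forall x, @cube R d x -> mk x <= 2^-1 * k`!%:R * eta ^+ (k - 2) * v x)
  (* (X_i, Y_i) i.i.d. copies of (X, Y); X'_i i.i.d. with law P of X,
     independent of the data *)
  (hXY : forall i (A : set (d.-tuple R * R)), measurable A ->
     Pr ((fun w => (X i w, Y i w)) @^-1` A) = Pr ((fun w => (X0 w, Y0 w)) @^-1` A))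
  (hXp : forall i (A : set (d.-tuple R)), measurable A ->
     Pr (Xp i @^-1` A) = Pr (X0 @^-1` A))
  (hind : mutually_independent Pr (fun i w => (X i w, Y i w)) Xp)
  (hBn : B <= Bn) (hdelta1 : 0 < delta1) (hdelta2 : 0 < delta2)
  (* the countable class F and the penalty L_n *)
  (F : set (d.-tuple R -> R)) (L : (d.-tuple R -> R) -> R)
  (hFc : countable F)
  (hFm : forall f, F f -> measurable_fun [set: d.-tuple R] f)
  (hFb : forall f, F f -> forall x, @cube R d x -> `|f x| <= Bn)
  (hL0 : forall f, F f -> 0 <= L f)
  (hLsum : (\esum_(f in F) (expR (- L f))%:E <= 1)%E) :
  let tau := (1 + delta1) * (1 + delta2) in
  let gam := gamma_n B Bn sigma eta delta1 delta2 in
  (\int[Pr]_w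
     ereal_sup [set (Dn' (fun i => Xp i w) f fstar
                     - tau * Pn (fun i => X i w) (fun i => Y i w) f fstar
                     - tau * gam * L f / n%:R)%:E | f in F] <= 0)%E.
Proof.
cbv zeta; set tau := (1 + delta1) * (1 + delta2).
set gam := gamma_n B Bn sigma eta delta1 delta2.
have B0 : 0 <= B by apply: le_trans (hB _ (hX0 point)).
have Bn0 : 0 <= Bn by exact: le_trans hBn.
have tau0 : 0 < tau by rewrite mulr_gt0// addr_gt0.
have n0 : 0 < n%:R :> R by rewrite ltr0n.
have heta0 := ltW heta.
have s20 : 0 <= sigma ^+ 2 by exact: sqr_ge0.
have mfs : measurable_fun setT fstar by case: hfstar.
have hXi i A : measurable A -> Pr (X i @^-1` A) = Pr (X0 @^-1` A).
  move=> mA; have := hXY i (A `*` setT) (measurableX mA measurableT).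
  congr (Pr _ = Pr _); apply/seteqP; split=> w //=; by [case|].
(* Here [f] and [fstar] vanish on the cube, where all sample points lie almost surely, so only the
   penalty, of the right sign, is left. *)
have [BBn|BBn] := eqVneq (B + Bn) 0.
  have BE : B = 0 by lra. have BnE : Bn = 0 by lra.
  have gam0 : 0 <= gam.
    rewrite /gam /gamma_n -/tau BBn expr0n/= mulr0 add0r mulr0 mul0r addr0.
    by rewrite mulr_ge0// mulr_ge0// addr_ge0// divr_ge0// ltW.
  apply: integral_le0_ae.
  have aeX : {ae Pr, forall w, forall i, @cube R d (X i w) /\ @cube R d (Xp i w)}.
    apply: ae_forall_ord => i.
    have H1 := ae_preimage_law (mX i) (measurable_cube (R := R) (d := d)) (hXi i) hX0.
    have H2 := ae_preimage_law (mXp i) (measurable_cube (R := R) (d := d)) (hXp i) hX0.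
    by apply: filterS2 H1 H2 => w c1 c2; split.
  apply: filterS aeX => w cw; apply: ge_ereal_sup => _ [f Ff <-].
  have f0 x : cube x -> f x = 0.
    by move=> cx; apply/eqP; rewrite -normr_le0 -BnE; exact: hFb.
  have fs0 x : cube x -> fstar x = 0.
    by move=> cx; apply/eqP; rewrite -normr_le0 -BE; exact: hB.
  rewrite lee_fin /Dn' /Pn !big1; last 2 first.
  - by move=> i _; case: (cw i) => cx _; rewrite f0// fs0// subrr.
  - by move=> i _; case: (cw i) => _ cx; rewrite f0// fs0// subrr expr0n.
  rewrite !mulr0 subrr sub0r oppr_le0.
  apply: divr_ge0 => //; apply: mulr_ge0; last exact: hL0.
  by apply: mulr_ge0 => //; exact: ltW.
have M0 : 0 < B + Bn by rewrite lt_neqAle eq_sym BBn addr_ge0.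
have gam0 : 0 < gam.
  rewrite /gam /gamma_n -/tau; apply: ltr_pwDr; first by rewrite !mulr_gt0.
  have d1 := ltW hdelta1; have d2 := ltW hdelta2.
  have f1 (x y : R) : 0 <= x -> 0 <= y -> 0 <= 1 + x / y.
    by move=> x0 y0; rewrite addr_ge0// divr_ge0.
  have t0 : 0 <= (2 * tau)^-1 by rewrite invr_ge0 mulr_ge0// ltW.
  apply: addr_ge0.
    by apply: mulr_ge0; [apply: mulr_ge0; [apply: mulr_ge0|]|exact: sqr_ge0] => //; exact: f1.
  by apply: mulr_ge0 => //; apply: mulr_ge0 => //; exact: f1.
have hb (k : nat) : (3 <= k)%N -> exists mk : d.-tuple R -> R,
    cond_exp_version Pr X0 (fun w => `|Y0 w - fstar (X0 w)| ^+ k) mk /\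
    forall w, mk (X0 w) <= 2^-1 * k`!%:R * eta ^+ (k - 2) * v (X0 w).
  by move=> /hbern[mk [cmk mkv]]; exists mk; split=> // w; exact: mkv.
have {hb} moments := bernstein_moments s20 heta0 hv (fun w => hsigma _ (hX0 w)) hb.
have e2oo : (\int[Pr]_w (`|Y0 w - fstar (X0 w)| ^+ 2)%:E < +oo)%E.
  have := moments 0 setT measurableT; rewrite preimage_setT => /le_lt_trans; apply.
  by rewrite integral_cst// [X in (_ * X)%E]probability_setT mule1 ltry.
have mean0 := centered_pos_neg mX0 mY0 hfstar (fun w => hB _ (hX0 w)) e2oo.
have expF f : F f -> (\int[Pr]_w (expR (n%:R / (tau * gam) *
   (Dn' (fun i => Xp i w) f fstar -
    tau * Pn (fun i => X i w) (fun i => Y i w) f fstar)))%:E <= 1)%E.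
  move=> Ff.
  have mf := hFm _ Ff.
  have fM w : `|f (X0 w) - fstar (X0 w)| <= B + Bn.
    rewrite (le_trans (ler_normB _ _))// addrC lerD//; first exact: hB.
    exact: hFb.
  have [cu [cw [Iu Iw cuw]]] := single_letter mX0 mY0 mf mfs M0 s20 heta0
    hdelta1 hdelta2 fM mean0 moments.
  rewrite -/tau -/(gamma_n B Bn sigma eta delta1 delta2) -/gam in Iu Iw.
  pose u (x : d.-tuple R) := expR (gam^-1 / tau * (f x - fstar x) ^+ 2).
  pose wf (z : d.-tuple R * R) :=
    expR (- gam^-1 * ((z.2 - f z.1) ^+ 2 - (z.2 - fstar z.1) ^+ 2)).
  have mu : measurable_fun setT u.
    apply: (measurableT_comp (@measurable_expR R)); apply: measurable_funM => //.
    by apply: measurable_funX; exact: measurable_funB.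
  have mwf : measurable_fun setT wf.
    apply: (measurableT_comp (@measurable_expR R)); apply: measurable_funM => //.
    have m2 : measurable_fun [set: d.-tuple R * R] snd by exact: measurable_snd.
    have m1 : measurable_fun [set: d.-tuple R * R] fst by exact: measurable_fst.
    apply: measurable_funB; apply: measurable_funX; apply: measurable_funB => //.
      exact: measurableT_comp.
    exact: measurableT_comp.
  have mZ i : measurable_fun setT (fun w => (X i w, Y i w)).
    exact: measurable_fun_pair.
  have mZ0 : measurable_fun setT (fun w => (X0 w, Y0 w)).
    exact: measurable_fun_pair.
  (* The disjoint sum of index sets joins data and ghost sample into one independent family of 2n
     factors. *)
  pose U (s : 'I_n + 'I_n) w :=
    match s with inl i => wf (X i w, Y i w) | inr i => u (Xp i w) end.
  pose c (s : 'I_n + 'I_n) := match s with inl i => cw | inr i => cu end.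
  have mU s : measurable_fun setT (U s).
    by case: s => i; [exact: (measurableT_comp mwf (mZ i))|
      exact: (measurableT_comp mu (mXp i))].
  have U0 s w : 0 <= U s w by case: s => i; exact: expR_ge0.
  have Uc s : (\int[Pr]_w (U s w)%:E <= (c s)%:E)%E.
    case: s => i /=.
      rewrite (integral_law_eq (mZ i) mZ0 mwf)//; first by move=> z; exact: expR_ge0.
      exact: hXY.
    rewrite (integral_law_eq (mXp i) mX0 mu)//; first by move=> z; exact: expR_ge0.
    exact: hXp.
  have indU (D : 'I_n + 'I_n -> set R) : (forall s, measurable (D s)) ->
      fine (Pr (\bigcap_(s in [set: 'I_n + 'I_n]) (U s @^-1` D s))) =
      \prod_s fine (Pr (U s @^-1` D s)).
    move=> mD; rewrite big_sumType/=.
    have := hind (fun i => wf @^-1` D (inl i)) (fun i => u @^-1` D (inr i)) _ _.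
    have mpw i : measurable (wf @^-1` D (inl i)).
      by rewrite -[X in measurable X]setTI; exact: mwf.
    have mpu i : measurable (u @^-1` D (inr i)).
      by rewrite -[X in measurable X]setTI; exact: mu.
    move=> /(_ mpw mpu) <-; congr (fine (Pr _)); apply/seteqP; split.
      by move=> w h; split=> i _; [exact: (h (inl i))|exact: (h (inr i))].
    by move=> w [h1 h2] [i|i] _; [exact: h1|exact: h2].
  have := integral_prod_indep mU U0 Uc indU.
  (* The factor n / (tau gam) cancels the averages 1/n, leaving 1/(gam tau) for each ghost term and
     -1/gam for each data term. *)
  rewrite (eq_integral (fun w => (expR (n%:R / (tau * gam) *
   (Dn' (fun i => Xp i w) f fstar -
    tau * Pn (fun i => X i w) (fun i => Y i w) f fstar)))%:E)); last first.
    move=> w _; rewrite big_sumType/= -!expR_sum -expRD; congr (expR _)%:E.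
    rewrite -!mulr_sumr /Dn' /Pn; field.
    by rewrite (gt_eqF n0) (gt_eqF gam0) (gt_eqF tau0).
  move=> /le_trans; apply.
  rewrite big_sumType/= !prodr_const card_ord -exprMn lee_fin.
  apply: exprn_ile1; last by rewrite mulrC.
  apply: mulr_ge0; rewrite -lee_fin.
    by apply: le_trans Iw; apply: integral_ge0 => w _; rewrite lee_fin expR_ge0.
  by apply: le_trans Iu; apply: integral_ge0 => w _; rewrite lee_fin expR_ge0.
have c0 : 0 < n%:R / (tau * gam) :> R by apply: divr_gt0 => //; exact: mulr_gt0.
(* The penalty tau gam L(f) / n is L(f) / c with c = n / (tau gam). *)
rewrite (eq_integral (fun w => ereal_sup [set (Dn' (fun i => Xp i w) f fstar -
    tau * Pn (fun i => X i w) (fun i => Y i w) f fstar -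
    L f / (n%:R / (tau * gam)))%:E | f in F])); last first.
  move=> w _; congr ereal_sup; apply: eq_imagel => f Ff; congr (_ - _)%:E.
  by field; rewrite (gt_eqF n0) (gt_eqF gam0) (gt_eqF tau0).
apply: (integral_sup_penalized_le0 (Q := fun f w =>
  Dn' (fun i => Xp i w) f fstar -
    tau * Pn (fun i => X i w) (fun i => Y i w) f fstar)) => // f Ff.
have mf := hFm _ Ff.
have mc (k : d.-tuple R -> R) (Z : Om -> d.-tuple R) :
    measurable_fun setT k -> measurable_fun setT Z ->
    measurable_fun setT (fun w => k (Z w)).
  by move=> mk mZ; exact: measurableT_comp.
apply: measurable_funB; apply: measurable_funM => //.
  apply: measurable_sum => i; apply: measurable_funX.
  by apply: measurable_funB; exact: mc.
apply: measurable_funM => //; apply: measurable_sum => i.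
by apply: measurable_funB; apply: measurable_funX; apply: measurable_funB => //; exact: mc.
Qed.
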